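(* Let $\Gamma$ be a finite simple connected graph with $d+1$ distinct eigenvalues, spectrum $\{\lambda_0^{m_0},\lambda_1^{m_1},\ldots,\lambda_d^{m_d}\}$ with $\lambda_0>\lambda_1>\cdots>\lambda_d$, and tridiagonal matrix $R$ of preintersection numbers. Then the spectrum of $\Gamma$ can be computed from $R$ as follows: (a) The different eigenvalues $\lambda_0>\lambda_1>\cdots>\lambda_d$ of $\Gamma$ are the eigenvalues of $R$, that is, the (distinct) zeros of its characteristic polynomial $\det(xI-R)$. (b) For $i=0,\ldots,d$, let $u_i$ and $v_i$ be, respectively, the left and right eigenvectors of $R$ corresponding to $\lambda_i$, each normalized to have first component $1$. Then the multiplicities are $$m_i=\frac{n}{\langle u_i,v_i\rangle},\qquad i=0,\ldots,d,$$ where $n=\langle u_0,v_0\rangle$ is the number of vertices of $\Gamma$ and $\langle\cdot,\cdot\rangle$ is the standard inner product on $\mathbb{R}^{d+1}$.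
   Context: Let $A$ be the adjacency matrix of $\Gamma$, $n$ the number of vertices; the spectrum consists of the distinct eigenvalues $\lambda_i$ of $A$ with their multiplicities $m_i$. The predistance polynomials $p_0,\ldots,p_d\in\mathbb{R}[x]$ are the unique polynomials with $\deg p_i=i$ that are orthogonal with respect to $\langle f,g\rangle_\Gamma=\frac1n\operatorname{tr}(f(A)g(A))=\frac1n\sum_{i=0}^d m_i f(\lambda_i)g(\lambda_i)$ and normalized so that $\|p_i\|_\Gamma^2=p_i(\lambda_0)$. The preintersection numbers $\alpha_i,\beta_i,\gamma_i$ considered are the coefficients of the three-term recurrence $xp_i=\beta_{i-1}p_{i-1}+\alpha_ip_i+\gamma_{i+1}p_{i+1}$, $i=0,\ldots,d$, with $\beta_{-1}=\gamma_{d+1}=0$ (for $i\le d-1$ an identity of polynomials; for $i=d$ an identity modulo the minimal polynomial $\prod_{i=0}^d(x-\lambda_i)$ of $A$). The matrix $R$, of size $(d+1)\times(d+1)$ with rows and columns indexed by $0,\ldots,d$, has entries $R_{i,i}=\alpha_i$, $R_{i,i+1}=\gamma_{i+1}$, $R_{i+1,i}=\beta_i$, and zeros elsewhere. *)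

(* Defs.v *)
From mathcomp Require Import all_boot all_order all_algebra.
Set Implicit Arguments. Unset Strict Implicit. Unset Printing Implicit Defensive.
Import Order.TTheory GRing.Theory Num.Theory.
Local Open Scope ring_scope.

Definition simple_graph (T : finType) (e : rel T) : Prop :=
  symmetric e /\ irreflexive e.

Definition connected_graph (T : finType) (e : rel T) : Prop :=
  (0 < #|T|)%N /\ forall x y : T, connect e x y.

Definition adjacency_mx (R : rcfType) (T : finType) (e : rel T) : 'M[R]_#|T| :=
  \matrix_(i, j) (e (enum_val i) (enum_val j))%:R.

(* [mup] in the characteristic polynomial is the algebraic multiplicity. *)
Definition is_spectrum (R : rcfType) (N : nat) (A : 'M[R]_N) (d : nat)
    (lambda : 'I_d.+1 -> R) (m : 'I_d.+1 -> nat) : Prop :=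
  [/\ forall i j : 'I_d.+1, (i < j)%N -> lambda j < lambda i,
      forall a : R, eigenvalue A a <-> exists i, a = lambda i
    & forall i, m i = mup (lambda i) (char_poly A)].

(* Agrees with [horner_mx A f], which is only available for sizes of the
   form N.+1. *)
Definition poly_mx (R : rcfType) (N : nat) (A : 'M[R]_N) (f : {poly R}) :
    'M[R]_N :=
  \sum_(k < size f) f`_k *: A ^+ k.

Definition spectral_ip (R : rcfType) (N : nat) (A : 'M[R]_N)
    (f g : {poly R}) : R :=
  N%:R^-1 * \tr (poly_mx A f *m poly_mx A g).

(* Only p 0, ..., p d are constrained; [size] is degree plus one. *)
Definition predistance_polys (R : rcfType) (N : nat) (A : 'M[R]_N) (d : nat)
    (lambda : 'I_d.+1 -> R) (p : nat -> {poly R}) : Prop :=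
  [/\ forall i, (i <= d)%N -> size (p i) = i.+1,
      forall i j, (i <= d)%N -> (j <= d)%N -> i != j ->
        spectral_ip A (p i) (p j) = 0
    & forall i, (i <= d)%N ->
        spectral_ip A (p i) (p i) = (p i).[lambda ord0]].

(* beta_{i-1} p_{i-1} + alpha_i p_i, with the convention beta_{-1} = 0 *)
Definition recurrence_low (R : rcfType) (alpha beta : nat -> R)
    (p : nat -> {poly R}) (i : nat) : {poly R} :=
  (if i is k.+1 then beta k *: p k else 0) + alpha i *: p i.

(* Only alpha_0, ..., alpha_d, beta_0, ..., beta_(d-1) and
   gamma_1, ..., gamma_d are constrained; the last relation, where
   gamma_(d+1) = 0, holds modulo the minimal polynomial of the adjacency
   matrix. *)
Definition preintersection_numbers (R : rcfType) (d : nat)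
    (lambda : 'I_d.+1 -> R) (p : nat -> {poly R})
    (alpha beta gamma : nat -> R) : Prop :=
  (forall i, (i < d)%N ->
     'X * p i = recurrence_low alpha beta p i + gamma i.+1 *: p i.+1)
  /\ \prod_(i < d.+1) ('X - (lambda i)%:P)
       %| 'X * p d - recurrence_low alpha beta p d.

Definition preintersection_mx (R : rcfType) (d : nat)
    (alpha beta gamma : nat -> R) : 'M[R]_d.+1 :=
  \matrix_(i, j)
    (if i == j :> nat then alpha i
     else if j == i.+1 :> nat then gamma i.+1
     else if i == j.+1 :> nat then beta j
     else 0).

Definition normalized_left_eigenvector (R : rcfType) (d : nat)
    (M : 'M[R]_d.+1) (a : R) (u : 'rV[R]_d.+1) : Prop :=
  u *m M = a *: u /\ u ord0 ord0 = 1.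

Definition normalized_right_eigenvector (R : rcfType) (d : nat)
    (M : 'M[R]_d.+1) (a : R) (v : 'cV[R]_d.+1) : Prop :=
  M *m v = a *: v /\ v ord0 ord0 = 1.

Definition std_ip (R : rcfType) (k : nat) (u : 'rV[R]_k) (v : 'cV[R]_k) : R :=
  \sum_(j < k) u ord0 j * v j ord0.

(* Main.v *)
Require Import Defs.
From mathcomp Require Import all_boot all_order all_algebra.
From mathcomp Require Import complex.
Set Implicit Arguments. Unset Strict Implicit. Unset Printing Implicit Defensive.
Import Order.TTheory GRing.Theory Num.Theory.
Local Open Scope ring_scope.
Local Open Scope sesquilinear_scope.

(** Write N for the number of vertices, lambda_0 > ... > lambda_d for the
    eigenvalues of the adjacency matrix A, m_j for their multiplicities, and
    let V be the matrix with entries V_ij = p_i(lambda_j).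

    Evaluating the three-term recurrence at lambda_j, which is a root of the
    modulus of its last relation, says that the j-th column of V is a right
    eigenvector of the preintersection matrix M for lambda_j; in matrix form
    M V = V L with L the diagonal matrix of the eigenvalues
    ([predistance_right_eigen]).

    A is symmetric, so it is diagonalizable with real eigenvalues, and the
    scalar product of polynomials is the weighted sum
    N^-1 sum_j m_j f(lambda_j) g(lambda_j) ([spectral_ipE]).  The orthogonality
    of the p_i therefore says that V, weighted by m_j / N, is inverse to the
    matrix W with entries W_ji = p_i(lambda_j) / p_i(lambda_0).  A one-sided
    inverse of a square matrix is two-sided, and exchanging the factors gives
    the dual orthogonality relation W V = diag(N / m_j)
    ([predistance_dual_orthogonality]).

    Consequently W is V^-1 up to a diagonal factor on the left, which commutes
    with L, so W M = L W and the rows of W are left eigenvectors.  Since the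
    lambda_j are distinct, eigenvectors are unique up to scaling; since
    p_0 = 1, the rows of W and the columns of V are the normalized ones.  The
    diagonal entries N / m_j of W V are therefore the products of the
    normalized left and right eigenvectors.

    It remains to see that m_0 = 1, which is where connectedness enters: if w
    is an eigenvector for the largest eigenvalue, then so is the vector of the
    moduli of its entries, because it maximizes the Rayleigh quotient, and a
    nonnegative eigenvector with a zero entry vanishes at all neighbours and
    hence everywhere ([max_eigenvector_eq0]).  Two independent eigenvectors
    could be combined to produce a zero entry. *)

(** * Diagonalization of real symmetric matrices *)

(** The spectral theorem applies over the complex extension R[i], where the
    matrix is Hermitian; the unitary matrix may be complex, but the diagonal is
    real, which is all that traces and characteristic polynomials see. *)
Lemma symmetric_spectral (R : rcfType) n (A : 'M[R]_n) : A^T = A ->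
  exists2 P : 'M[R[i]]_n, P \is unitarymx & exists r : 'rV[R]_n,
    map_mx (real_complex R) A =
    invmx P *m diag_mx (map_mx (real_complex R) r) *m P.
Proof.
move=> symA; pose B := map_mx (real_complex R) A.
have hermB : B \is hermsymmx.
  apply: realsym_hermsym.
    by apply/is_hermitianmxP; rewrite expr0 scale1r map_mx_id // map_trmx symA.
  by apply/mxOverP => i j; rewrite mxE; apply/complex_realP; exists (A i j).
have /mxOverP realD := hermitian_spectral_diag_real hermB.
exists (spectralmx B); first exact: spectral_unitarymx.
exists (\row_k complex.Re (spectral_diag B 0 k)).
rewrite [LHS](orthomx_spectralP (hermitian_normalmx hermB)).
congr (_ *m diag_mx _ *m _); apply/rowP=> k; rewrite !mxE.
exact/esym/RRe_real/realD.
Qed.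

Lemma char_poly_diag (F : fieldType) n (r : 'rV[F]_n) :
  char_poly (diag_mx r) = \prod_k ('X - (r 0 k)%:P).
Proof.
rewrite char_poly_trig ?diag_mx_is_trig //.
by apply: eq_bigr => k _; rewrite mxE eqxx.
Qed.

Lemma char_poly_conj (F : fieldType) n (P D : 'M[F]_n) : P \in unitmx ->
  char_poly (invmx P *m D *m P) = char_poly D.
Proof.
move=> Pu; pose Q := map_mx (@polyC F) P.
pose Q' := map_mx (@polyC F) (invmx P).
have Q'Q : Q' *m Q = 1%:M by rewrite -map_mxM mulVmx // map_mx1.
rewrite /char_poly.
have -> : char_poly_mx (invmx P *m D *m P) = Q' *m char_poly_mx D *m Q.
  rewrite /char_poly_mx mulmxBr mulmxBl !map_mxM.
  by congr (_ - _); rewrite scalar_mxC -mulmxA Q'Q mulmx1.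
by rewrite !det_mulmx mulrAC -det_mulmx Q'Q det1 mul1r.
Qed.

Lemma exp_conj_diag (F : fieldType) n (P : 'M[F]_n) (r : 'rV[F]_n) k :
  P \in unitmx ->
  (invmx P *m diag_mx r *m P) ^+ k =
  invmx P *m diag_mx (map_mx (fun x => x ^+ k) r) *m P.
Proof.
move=> Pu; elim: k => [|k IHk].
  rewrite expr0; have -> : diag_mx (map_mx (fun x => x ^+ 0) r) = 1%:M.
    by apply/matrixP=> i j; rewrite !mxE expr0.
  by rewrite mulmx1 mulVmx.
rewrite exprS IHk -mulmxE !mulmxA mulmxK //.
rewrite -[_ *m diag_mx r *m _]mulmxA mulmx_diag; congr (_ *m diag_mx _ *m _).
by apply/rowP=> i; rewrite !mxE exprS.
Qed.

Lemma map_poly_mx_conj_diag (R : rcfType) n (A : 'M[R]_n) (P : 'M[R[i]]_n)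
    (r : 'rV[R]_n) (f : {poly R}) : P \in unitmx ->
  map_mx (real_complex R) A =
    invmx P *m diag_mx (map_mx (real_complex R) r) *m P ->
  map_mx (real_complex R) (poly_mx A f) =
    invmx P *m diag_mx (map_mx (real_complex R) (map_mx (horner f) r)) *m P.
Proof.
move=> Pu defA; rewrite /poly_mx raddf_sum /=.
have powA k : map_mx (real_complex R) (A ^+ k) = map_mx (real_complex R) A ^+ k.
  elim: k => [|k IHk]; first by rewrite !expr0 map_mx1.
  by rewrite !exprS -!mulmxE map_mxM IHk.
under eq_bigr => k _.
  rewrite map_mxZ powA defA exp_conj_diag // scalemxAl scalemxAr.
over.
rewrite -mulmx_suml -mulmx_sumr; congr (_ *m _ *m _).
apply/matrixP=> i j; rewrite summxE !mxE horner_coef.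
under eq_bigr do rewrite !mxE mulrnAr.
rewrite sumrMnl; congr (_ *+ _); rewrite rmorph_sum /=.
by apply: eq_bigr => k _; rewrite rmorphM rmorphXn.
Qed.

Lemma trace_conj_diag (F : fieldType) n (P : 'M[F]_n) (r s : 'rV[F]_n) :
  P \in unitmx ->
  \tr (invmx P *m diag_mx r *m P *m (invmx P *m diag_mx s *m P)) =
  \sum_k r 0 k * s 0 k.
Proof.
move=> Pu; rewrite mulmxA mulmxA mulmxK // mxtrace_mulC.
rewrite !mulmxA mulmxV // mul1mx.
by rewrite mulmx_diag mxtrace_diag; apply: eq_bigr => k _; rewrite mxE.
Qed.

Lemma trace_poly_mx (R : rcfType) n (A : 'M[R]_n) (P : 'M[R[i]]_n)
    (r : 'rV[R]_n) (f g : {poly R}) : P \in unitmx ->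
  map_mx (real_complex R) A =
    invmx P *m diag_mx (map_mx (real_complex R) r) *m P ->
  \tr (poly_mx A f *m poly_mx A g) = \sum_k f.[r 0 k] * g.[r 0 k].
Proof.
move=> Pu defA; apply: (@complexI R).
rewrite -trace_map_mx map_mxM !(map_poly_mx_conj_diag _ Pu defA).
rewrite trace_conj_diag // rmorph_sum; apply: eq_bigr => k _.
by rewrite !mxE -rmorphM.
Qed.

Lemma char_poly_real_conj_diag (R : rcfType) n (A : 'M[R]_n) (P : 'M[R[i]]_n)
    (r : 'rV[R]_n) : P \in unitmx ->
  map_mx (real_complex R) A =
    invmx P *m diag_mx (map_mx (real_complex R) r) *m P ->
  char_poly A = \prod_k ('X - (r 0 k)%:P).
Proof.
move=> Pu defA; apply: (map_poly_inj (real_complex R)).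
rewrite map_char_poly defA char_poly_conj // char_poly_diag rmorph_prod /=.
by apply: eq_bigr => k _; rewrite map_polyXsubC mxE.
Qed.

Lemma mup_prod_XsubC (F : fieldType) n (r : 'I_n -> F) (a : F) :
  mup a (\prod_k ('X - (r k)%:P)) = #|[pred k | r k == a]|.
Proof.
rewrite -(big_map r xpredT (fun x => 'X - x%:P)) mu_prod_XsubC.
by rewrite count_map -sum1_count sum1_card.
Qed.

(** In the unitary coordinates z of y, the Rayleigh quotient reads
    sum_k (r_k - a) |z_k|^2, a sum of nonpositive terms.  If it is nonnegative,
    every term vanishes, so z is supported on the indices with r_k = a. *)
Lemma rayleigh_max_eigenvector (C : numClosedFieldType) n (P B : 'M[C]_n)
    (r : 'rV[C]_n) (a : C) (y : 'rV[C]_n) : P \is unitarymx ->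
  B = invmx P *m diag_mx r *m P -> (forall k, r 0 k <= a) ->
  0 <= ((y *m (B - a%:M)) *m y^t*) 0 0 -> y *m B = a *: y.
Proof.
move=> Pu defB le_ra; pose z := y *m P^t*.
have defy : y = z *m P by rewrite mulmxKtV.
have yB : y *m (B - a%:M) = (z *m (diag_mx r - a%:M)) *m P.
  rewrite defB invmx_unitary // !(mulmxBr, mulmxBl) !mulmxA -/z.
  by rewrite !mul_mx_scalar -scalemxAl -defy.
clearbody z.
have -> : (y *m (B - a%:M) *m y^t*) 0 0 = \sum_k (r 0 k - a) * `|z 0 k| ^+ 2.
  rewrite yB {1}defy trmx_mul map_mxM mulmxA mulmxtVK // mxE.
  apply: eq_bigr => k _; rewrite mulmxBr mul_mx_diag mul_mx_scalar !mxE.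
  by rewrite normCK; rewrite [a * _]mulrC -mulrBr mulrAC mulrC.
have term_le0 k : (r 0 k - a) * `|z 0 k| ^+ 2 <= 0.
  by rewrite mulr_le0_ge0 ?subr_le0 ?exprn_ge0.
move=> sum_ge0.
have term0 k : (r 0 k - a) * `|z 0 k| ^+ 2 = 0.
  apply: oppr_inj; rewrite oppr0.
  pose t k := - ((r 0 k - a) * `|z 0 k| ^+ 2).
  apply: (psumr_eq0P (P := xpredT) (F := t)) => //.
    by move=> i _; rewrite oppr_ge0.
  apply/eqP; rewrite sumrN oppr_eq0 eq_le sum_ge0 andbT.
  by apply: sumr_le0.
suff: y *m (B - a%:M) = 0.
  by rewrite mulmxBr mul_mx_scalar => /eqP; rewrite subr_eq0 => /eqP.
rewrite yB; have -> : z *m (diag_mx r - a%:M) = 0; last by rewrite mul0mx.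
apply/rowP=> k; rewrite mulmxBr mul_mx_diag mul_mx_scalar !mxE.
rewrite [a * _]mulrC -mulrBr; apply/eqP.
by have /eqP := term0 k; rewrite mulf_eq0 expf_eq0 normr_eq0 mulf_eq0 orbC.
Qed.

(** * Simplicity of the largest eigenvalue of a connected graph *)

Lemma adjacency_mx_sym (R : rcfType) (T : finType) (e : rel T) :
  symmetric e -> (adjacency_mx R e)^T = adjacency_mx R e.
Proof. by move=> symE; apply/matrixP => i j; rewrite !mxE symE. Qed.

Lemma connected_ind (T : finType) (e : rel T) (Z : pred T) (x0 : T) :
  symmetric e -> connected_graph e -> Z x0 ->
  (forall x y, e x y -> Z x -> Z y) -> forall x, Z x.
Proof.
move=> symE [_ conn] Zx0 stepZ x.
have closedZ : closed e Z.
  by move=> y z eyz; apply/idP/idP; apply: stepZ; rewrite // symE.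
by have := closed_connect closedZ (conn x0 x); rewrite -!topredE /= Zx0 => <-.
Qed.

(** Let y be the vector of the moduli of the entries of w.  The triangle
    inequality gives y B >= a y entrywise, hence y (B - a) y^* >= 0, so y is
    again an eigenvector for the maximal eigenvalue a.  At a zero entry of y
    the eigenvalue equation is a vanishing sum of nonnegative terms, so y
    vanishes at all the neighbours, and by connectedness everywhere. *)
Lemma max_eigenvector_eq0 (R : rcfType) (T : finType) (e : rel T)
    (P : 'M[R[i]]_#|T|) (r : 'rV[R]_#|T|) (a : R) (w : 'rV[R[i]]_#|T|)
    (i0 : 'I_#|T|) :
  symmetric e -> connected_graph e -> P \is unitarymx ->
  map_mx (real_complex R) (adjacency_mx R e) =
    invmx P *m diag_mx (map_mx (real_complex R) r) *m P ->
  (forall k, r 0 k <= a) ->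
  w *m map_mx (real_complex R) (adjacency_mx R e) = real_complex R a *: w ->
  w 0 i0 = 0 -> w = 0.
Proof.
move=> symE conn Pu defA le_ra; set B := map_mx _ _ => wB w0.
have BE i j : B i j = (e (enum_val i) (enum_val j))%:R.
  by rewrite !mxE rmorph_nat.
have B_ge0 i j : 0 <= B i j by rewrite BE.
pose y : 'rV[R[i]]_#|T| := \row_i `|w 0 i|.
have y_ge0 i : 0 <= y 0 i by rewrite mxE.
have yBa_ge0 i : 0 <= (y *m (B - (real_complex R a)%:M)) 0 i.
  rewrite mulmxBr mul_mx_scalar mxE [X in _ + X]mxE [X in _ - X]mxE subr_ge0.
  apply: (@le_trans _ _ `|(w *m B) 0 i|).
    rewrite wB !mxE normrM ler_wpM2r // real_ler_norm //.
    by apply/complex_realP; exists a.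
  rewrite !mxE; apply: le_trans (ler_norm_sum _ _ _) _.
  apply: ler_sum => j _; rewrite normrM [y 0 j]mxE.
  by rewrite (ger0_norm (B_ge0 j i)).
have yB : y *m B = real_complex R a *: y.
  apply: (rayleigh_max_eigenvector Pu defA) => [k|]; first by rewrite mxE lecR.
  rewrite mxE; apply: sumr_ge0 => i _; apply: mulr_ge0 => //.
  by rewrite !mxE geC0_conj.
have zero : forall x, w 0 (enum_rank x) == 0.
  apply: (connected_ind (x0 := enum_val i0) symE conn).
    by rewrite enum_valK w0.
  move=> x x' exx' /eqP wx.
  have /eqP := congr1 (fun u : 'rV[R[i]]_#|T| => u 0 (enum_rank x)) yB.
  rewrite [X in _ == X]mxE [y 0 _]mxE wx normr0 mulr0 mxE psumr_eq0; last first.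
    by move=> j _; rewrite mulr_ge0.
  move=> /allP /(_ (enum_rank x') (mem_index_enum _)) /=.
  by rewrite BE !enum_rankK symE exx' mulr1 mxE normr_eq0.
by apply/rowP=> i; rewrite mxE -(enum_valK i); apply/eqP/zero.
Qed.

(** If k and l were different indices carrying the largest eigenvalue, the
    combination of the rows k and l of the unitary matrix that cancels the
    k-th entry would be null.  As the rows are independent, its coefficients
    vanish, and one of them is the k-th entry of row k; so row k would itself
    be null. *)
Lemma max_eigenvalue_simple (R : rcfType) (T : finType) (e : rel T)
    (P : 'M[R[i]]_#|T|) (r : 'rV[R]_#|T|) (k l : 'I_#|T|) :
  symmetric e -> connected_graph e -> P \is unitarymx ->
  map_mx (real_complex R) (adjacency_mx R e) =
    invmx P *m diag_mx (map_mx (real_complex R) r) *m P ->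
  (forall h, r 0 h <= r 0 k) -> r 0 l = r 0 k -> l = k.
Proof.
move=> symE conn Pu defA max_k rlk; apply/eqP/negPn/negP => neq_lk.
have Punit := unitarymx_unit Pu; set B := map_mx _ _ in defA.
have rowB h : row h P *m B = real_complex R (r 0 h) *: row h P.
  rewrite -row_mul defA !mulmxA mulmxV // mul1mx mul_diag_mx.
  by apply/rowP=> j; rewrite !mxE.
pose c := P k k; pose c' := P l k.
have comb0 : c *: row l P - c' *: row k P = 0.
  apply: (max_eigenvector_eq0 (i0 := k) symE conn Pu defA max_k).
    rewrite mulmxBl -!scalemxAl !rowB rlk scalerBr !scalerA.
    by rewrite ![real_complex R _ * _]mulrC.
  by rewrite !mxE mulrC subrr.
have delta0 : c *: delta_mx 0 l - c' *: delta_mx 0 k = 0 :> 'rV_#|T|.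
  apply: (can_inj (mulmxK Punit)); rewrite mul0mx.
  by rewrite mulmxBl -!scalemxAl -!rowE.
have c0 : c = 0.
  have /rowP/(_ l) := delta0.
  by rewrite !mxE !eqxx (negPf neq_lk) mulr1 mulr0 subr0.
have rowk0 : row k P = 0.
  apply: (max_eigenvector_eq0 (i0 := k) symE conn Pu defA max_k (rowB k)).
  by rewrite mxE.
have : delta_mx 0 k = 0 :> 'rV[R[i]]_#|T|.
  by apply: (can_inj (mulmxK Punit)); rewrite mul0mx -rowE.
by move/rowP/(_ k)/eqP; rewrite !mxE !eqxx oner_eq0.
Qed.

(** * The trace form in terms of the spectrum *)

Section Spectrum.
Variables (R : rcfType) (n : nat) (A : 'M[R]_n) (d : nat).
Variables (lambda : 'I_d.+1 -> R) (m : 'I_d.+1 -> nat).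
Hypothesis spectrumA : is_spectrum A lambda m.

Lemma spectrum_inj : injective lambda.
Proof.
have [decr _ _] := spectrumA.
move=> i j eq_ij; apply: val_inj => /=.
by case: (ltngtP i j) => // /decr; rewrite eq_ij ltxx.
Qed.

Lemma spectrum_le_max i : lambda i <= lambda ord0.
Proof.
have [decr _ _] := spectrumA.
have [i0|i_gt0] := posnP i; last exact/ltW/decr.
by rewrite (_ : i = ord0) //; apply: val_inj.
Qed.

Lemma spectrum_mult_gt0 i : (0 < m i)%N.
Proof.
have [_ eigA ->] := spectrumA.
rewrite -XsubC_dvd ?monic_neq0 ?char_poly_monic //.
by rewrite dvdp_XsubCl -eigenvalue_root_char; apply/eigA; exists i.
Qed.

Variables (P : 'M[R[i]]_n) (r : 'rV[R]_n).
Hypotheses (Pu : P \in unitmx)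
  (defA : map_mx (real_complex R) A =
    invmx P *m diag_mx (map_mx (real_complex R) r) *m P).

Lemma spectrum_diag k : exists i, r 0 k = lambda i.
Proof.
have [_ eigA _] := spectrumA; apply/eigA.
rewrite eigenvalue_root_char (char_poly_real_conj_diag Pu defA).
by rewrite (bigD1 k) //= rootM root_XsubC eqxx.
Qed.

Lemma spectrum_mult i : m i = #|[pred k | r 0 k == lambda i]|.
Proof.
have [_ _ ->] := spectrumA.
by rewrite (char_poly_real_conj_diag Pu defA) mup_prod_XsubC.
Qed.

(** Grouping equal diagonal entries turns sums over the diagonal form, such as
    traces, into sums over the distinct eigenvalues weighted by their algebraic
    multiplicities. *)
Lemma sum_spectrum (F : R -> R) :
  \sum_k F (r 0 k) = \sum_i (m i)%:R * F (lambda i).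
Proof.
have [idx idxP] := fin_all_exists spectrum_diag.
rewrite (partition_big idx xpredT) //=; apply: eq_bigr => i _.
rewrite spectrum_mult mulr_natl -sumr_const; apply: eq_big => [k|k /eqP <-].
  by rewrite inE idxP (inj_eq spectrum_inj).
by rewrite idxP.
Qed.

End Spectrum.

Lemma spectral_ipE (R : rcfType) n (A : 'M[R]_n) d (lambda : 'I_d.+1 -> R)
    (m : 'I_d.+1 -> nat) (f g : {poly R}) :
  A^T = A -> is_spectrum A lambda m ->
  spectral_ip A f g =
    n%:R^-1 * \sum_i (m i)%:R * (f.[lambda i] * g.[lambda i]).
Proof.
move=> symA spA; have [P Pu [r defA]] := symmetric_spectral symA.
rewrite /spectral_ip (trace_poly_mx _ _ (unitarymx_unit Pu) defA).
by rewrite (sum_spectrum spA (unitarymx_unit Pu) defA (fun x => f.[x] * g.[x])).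
Qed.

Lemma max_eigenvalue_mult1 (R : rcfType) (T : finType) (e : rel T) d
    (lambda : 'I_d.+1 -> R) (m : 'I_d.+1 -> nat) :
  symmetric e -> connected_graph e ->
  is_spectrum (adjacency_mx R e) lambda m -> m ord0 = 1%N.
Proof.
move=> symE conn spA.
have [P Pu [r defA]] := symmetric_spectral (adjacency_mx_sym R symE).
have Punit := unitarymx_unit Pu.
apply/eqP; rewrite eqn_leq (spectrum_mult_gt0 spA) andbT.
rewrite (spectrum_mult spA Punit defA); apply/card_le1_eqP => k l.
rewrite !inE => /eqP rk /eqP rl.
apply: (max_eigenvalue_simple symE conn Pu defA); last by rewrite rk rl.
move=> h; have [i ->] := spectrum_diag spA Punit defA h.
by rewrite ?rk ?rl; apply: spectrum_le_max spA _.
Qed.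

(** * Eigenvectors of a matrix with simple spectrum *)

(** The setting is a matrix M with a full family of right eigenvectors, the
    columns of V, and a matrix W which inverts V up to a diagonal factor. *)
Section Diagonalization.
Variables (R : rcfType) (d : nat) (M V W : 'M[R]_d.+1).
Variables (lambda c : 'I_d.+1 -> R).
Hypotheses (lambda_inj : injective lambda) (c_neq0 : forall i, c i != 0).
Hypotheses (MV : M *m V = V *m diag_mx (\row_i lambda i))
  (WV : W *m V = diag_mx (\row_i c i)).
Hypotheses (V0 : forall i, V ord0 i = 1) (W0 : forall i, W i ord0 = 1).

Let L := diag_mx (\row_i lambda i).
Let U := diag_mx (\row_i (c i)^-1) *m W.

Lemma scaled_left_inverse : U *m V = 1%:M.
Proof.
rewrite -mulmxA WV mulmx_diag; apply/matrixP => i j; rewrite !mxE.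
by rewrite mulVf.
Qed.

Lemma scaled_right_inverse : V *m U = 1%:M.
Proof. exact/mulmx1C/scaled_left_inverse. Qed.

Lemma unscale_left_inverse : W = diag_mx (\row_i c i) *m U.
Proof.
rewrite mulmxA mulmx_diag mul_diag_mx; apply/matrixP => i j.
by rewrite !mxE divff // mul1r.
Qed.

Lemma diagonalization : M = V *m L *m U.
Proof. by rewrite -MV -mulmxA scaled_right_inverse mulmx1. Qed.

(** W is V^-1 up to a diagonal factor, and diagonal matrices commute. *)
Lemma left_eigenvectors_of_inverse : W *m M = L *m W.
Proof.
rewrite {2}unscale_left_inverse diagonalization !mulmxA WV.
by rewrite [_ *m L]diag_mxC.
Qed.

Lemma char_poly_diagonalized :
  char_poly M = \prod_i ('X - (lambda i)%:P).
Proof.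
have [Vu Uu] := mulmx1_unit scaled_right_inverse.
have Vinv : invmx U = V.
  by rewrite -[invmx U]mul1mx -scaled_right_inverse mulmxK.
rewrite diagonalization -Vinv char_poly_conj // char_poly_diag.
by apply: eq_bigr => i _; rewrite mxE.
Qed.

Lemma root_char_poly_diagonalized a :
  root (char_poly M) a <-> exists i, a = lambda i.
Proof.
rewrite char_poly_diagonalized; split.
  rewrite /root horner_prod => /prodf_eq0 [i _].
  by rewrite hornerXsubC subr_eq0 => /eqP ->; exists i.
by move=> [i ->]; rewrite (bigD1 i) //= rootM root_XsubC eqxx.
Qed.

(** The coordinates x of an eigenvector in the basis of the columns of V
    satisfy (lambda_j - lambda_i) x_j = 0, so only x_i survives, and the
    normalization of both vectors makes it 1. *)
Lemma normalized_right_eigenvectorE i v :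
  normalized_right_eigenvector M (lambda i) v <-> v = col i V.
Proof.
split=> [[Mv v0]|->]; last first.
  split; last by rewrite mxE V0.
  rewrite colE mulmxA MV -!colE mul_mx_diag; apply/colP=> j.
  by rewrite !mxE mulrC.
pose x := U *m v.
have defv : v = V *m x by rewrite mulmxA scaled_right_inverse mul1mx.
have Lx : L *m x = lambda i *: x.
  rewrite /x scalemxAr -Mv diagonalization.
  by move: (U) scaled_left_inverse => Z ZV; rewrite !mulmxA ZV mul1mx.
have x0 j : j != i -> x j 0 = 0.
  move=> neq_ji; have /colP/(_ j)/eqP := Lx.
  rewrite mul_diag_mx !mxE -subr_eq0 -mulrBl mulf_eq0 subr_eq0.
  by rewrite (inj_eq lambda_inj) (negPf neq_ji) => /eqP.
have Vx k : v k 0 = V k i * x i 0.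
  rewrite {1}defv mxE (bigD1 i) //= big1 ?addr0 //.
  by move=> j /x0 ->; rewrite mulr0.
have xi : x i 0 = 1 by rewrite -v0 Vx V0 mul1r.
by apply/colP=> k; rewrite Vx xi mulr1 mxE.
Qed.

Lemma normalized_left_eigenvectorE i u :
  normalized_left_eigenvector M (lambda i) u <-> u = row i W.
Proof.
split=> [[uM u0]|->]; last first.
  split; last by rewrite mxE W0.
  rewrite -row_mul left_eigenvectors_of_inverse mul_diag_mx; apply/rowP=> j.
  by rewrite !mxE.
pose x := u *m V *m diag_mx (\row_i (c i)^-1).
have defu : u = x *m W by rewrite -!mulmxA scaled_right_inverse mulmx1.
have xL : x *m L = lambda i *: x.
  by rewrite -mulmxA diag_mxC mulmxA -[_ *m L]mulmxA -MV mulmxA uM -!scalemxAl.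
clearbody x.
have x0 j : j != i -> x 0 j = 0.
  move=> neq_ji; have /rowP/(_ j)/eqP := xL.
  rewrite mul_mx_diag !mxE mulrC -subr_eq0 -mulrBl mulf_eq0 subr_eq0.
  by rewrite (inj_eq lambda_inj) (negPf neq_ji) => /eqP.
have xW k : u 0 k = x 0 i * W i k.
  rewrite {1}defu mxE (bigD1 i) //= big1 ?addr0 //.
  by move=> j /x0 ->; rewrite mul0r.
have xi : x 0 i = 1 by rewrite -u0 xW W0 mulr1.
by apply/rowP=> k; rewrite xW xi mul1r mxE.
Qed.

Lemma std_ip_eigenvectors i : std_ip (row i W) (col i V) = c i.
Proof.
have /matrixP/(_ i i) := WV; rewrite !mxE eqxx mulr1n => <-.
by apply: eq_bigr => j _; rewrite !mxE.
Qed.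
End Diagonalization.

(** * Predistance polynomials and preintersection numbers *)

Lemma sum_ord_delta (R : pzRingType) n (g : nat -> R) j :
  \sum_(k < n) (k == j :> nat)%:R * g k = if (j < n)%N then g j else 0.
Proof.
case: ltnP => [lt_jn|le_nj].
  rewrite (bigD1 (Ordinal lt_jn)) //= eqxx mul1r big1 ?addr0 // => k.
  by rewrite -val_eqE /= => /negPf->; rewrite mul0r.
rewrite big1 // => k _; rewrite (ltn_eqF (leq_trans (ltn_ord k) le_nj)).
by rewrite mul0r.
Qed.

(** The i-th row of the tridiagonal matrix applied to a sequence f is the
    right-hand side of the three-term recurrence. *)
Lemma preintersection_mx_mulE (R : rcfType) d (alpha beta gamma f : nat -> R)
    (i : 'I_d.+1) :
  \sum_k preintersection_mx d alpha beta gamma i k * f k =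
  (if (i : nat) is k.+1 then beta k * f k else 0) + alpha i * f i +
  (if (i < d)%N then gamma i.+1 * f i.+1 else 0).
Proof.
(* Each entry of the matrix is the sum of its three diagonal parts. *)
pose b k := if (i : nat) is l.+1 then (k == l)%:R * (beta k * f k) else 0.
transitivity (\sum_(k < d.+1) (b k + (k == i :> nat)%:R * (alpha k * f k)
    + (k == i.+1 :> nat)%:R * (gamma k * f k))).
  apply: eq_bigr => k _; rewrite mxE /b.
  case: i {b} => -[|i] lti /=.
    rewrite add0r; case: k => -[|[|k]] ltk /=;
    by rewrite ?eqxx /= !(mul0r, mul1r, addr0, add0r).
  have [eq_ki|ne_ki] := eqVneq (k : nat) i.+1.
    rewrite eq_ki (gtn_eqF (ltnSn i)) (ltn_eqF (ltnSn i.+1)).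
    by rewrite !(mul0r, mul1r, addr0, add0r).
  rewrite mul0r addr0 eqSS [i == k]eq_sym.
  have [eq_ki|_] := eqVneq (k : nat) i.+2.
    by rewrite eq_ki gtn_eqF ?leqnSn // mul0r add0r mul1r.
  by rewrite mul0r addr0; case: ifP => _; rewrite ?mul1r ?mul0r.
rewrite !big_split /= (sum_ord_delta _ (fun k => alpha k * f k)) ltn_ord.
rewrite (sum_ord_delta _ (fun k => gamma k * f k)) ltnS; congr (_ + _ + _).
rewrite /b; case: i {b} => -[|i] lti /=; first by rewrite big1.
by rewrite (sum_ord_delta _ (fun k => beta k * f k)) ltnW.
Qed.

Section Predistance.
Variables (R : rcfType) (n : nat) (A : 'M[R]_n) (d : nat).
Variables (lambda : 'I_d.+1 -> R) (m : 'I_d.+1 -> nat) (p : nat -> {poly R}).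
Variables (alpha beta gamma : nat -> R).
Hypotheses (n_gt0 : (0 < n)%N) (symA : A^T = A)
  (spectrumA : is_spectrum A lambda m)
  (p_predist : predistance_polys A lambda p)
  (p_rec : preintersection_numbers lambda p alpha beta gamma).

Let M := preintersection_mx d alpha beta gamma.
Let V : 'M[R]_d.+1 := \matrix_(i, j) (p i).[lambda j].
Let W : 'M[R]_d.+1 := \matrix_(i, j) ((p j).[lambda i] / (p j).[lambda ord0]).

Lemma predistance_right_eigen : M *m V = V *m diag_mx (\row_i lambda i).
Proof.
have [recl recd] := p_rec.
rewrite mul_mx_diag; apply/matrixP => i j; rewrite 4!mxE.
under eq_bigr do rewrite [V _ _]mxE.
rewrite (preintersection_mx_mulE _ _ _ (fun k => (p k).[lambda j])).
have lowE k : (recurrence_low alpha beta p k).[lambda j] =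
    (if k is l.+1 then beta l * (p l).[lambda j] else 0) +
    alpha k * (p k).[lambda j].
  by rewrite /recurrence_low; case: k => [|k]; rewrite !hornerE.
rewrite -lowE [RHS]mulrC; case: ltnP => [lt_id|le_di].
  by rewrite -hornerZ -hornerD -recl // hornerM hornerX.
have -> : i = d :> nat by apply/eqP; rewrite eqn_leq le_di -ltnS ltn_ord.
have : ('X * p d - recurrence_low alpha beta p d).[lambda j] = 0.
  apply/eqP; rewrite -/(root _ _) -dvdp_XsubCl; apply: dvdp_trans recd.
  by rewrite (bigD1 j) //= dvdp_mulIl.
rewrite hornerD hornerN hornerM hornerX addr0.
by move=> /eqP; rewrite subr_eq0 => /eqP->.
Qed.

(** By the normalization p_i(lambda_0) is the squared norm of p_i.  If it
    were zero, p_i, of degree at most d, would vanish at the d + 1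
    eigenvalues. *)
Lemma predistance_max_neq0 i : (i <= d)%N -> (p i).[lambda ord0] != 0.
Proof.
have [p_size _ p_norm] := p_predist.
move=> le_id; apply/eqP => pi0.
have n_neq0 : n%:R != 0 :> R by rewrite pnatr_eq0 -lt0n.
have /eqP := p_norm i le_id.
rewrite pi0 (spectral_ipE _ _ symA spectrumA).
rewrite mulf_eq0 invr_eq0 (negPf n_neq0) /=.
rewrite psumr_eq0 => [/allP roots|j _]; last first.
  by rewrite mulr_ge0 ?ler0n // -expr2 sqr_ge0.
have : (size [seq lambda j | j : 'I_d.+1] < size (p i))%N.
  apply: max_poly_roots.
  - by rewrite -size_poly_eq0 p_size.
  - apply/allP => _ /imageP [j _ ->]; have := roots j (mem_index_enum j).
    rewrite /= !mulf_eq0 orbb pnatr_eq0.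
    by rewrite eqn0Ngt (spectrum_mult_gt0 spectrumA).
  - by rewrite map_inj_uniq ?enum_uniq //; apply: spectrum_inj spectrumA.
by rewrite size_map size_enum_ord p_size // ltnS ltnNge le_id.
Qed.

(** For a constant c, the normalization reads c^2 = c, with c != 0. *)
Lemma predistance_p0 : p 0%N = 1.
Proof.
have [p_size _ p_norm] := p_predist.
have /size_poly1P [c c_neq0 p0] : size (p 0%N) == 1%N by rewrite p_size.
have n_neq0 : n%:R != 0 :> R by rewrite pnatr_eq0 -lt0n.
have := p_norm 0%N (leq0n d); rewrite p0 hornerC /spectral_ip.
have -> : poly_mx A c%:P = c%:M.
  rewrite /poly_mx size_polyC c_neq0 big_ord1 coefC expr0 /=.
  by rewrite -scalemx1.
rewrite -scalar_mxM mxtrace_scalar -[c * c *+ n]mulr_natl mulKf // => cc.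
by rewrite (mulfI c_neq0 (etrans cc (esym (mulr1 c)))).
Qed.

(** Orthogonality of the p_i is V D W = 1 with D = diag(m_i / n); hence
    D W V = 1. *)
Lemma predistance_dual_orthogonality :
  W *m V = diag_mx (\row_i (n%:R / (m i)%:R)).
Proof.
have [p_size p_orth p_norm] := p_predist.
have n_neq0 : n%:R != 0 :> R by rewrite pnatr_eq0 -lt0n.
pose D := diag_mx (\row_i ((m i)%:R / n%:R : R)).
have orth : V *m (D *m W) = 1%:M.
  apply/matrixP => i k; rewrite !mxE.
  have -> : \sum_j V i j * (D *m W) j k =
      spectral_ip A (p i) (p k) / (p k).[lambda ord0].
    rewrite (spectral_ipE _ _ symA spectrumA) mulr_sumr mulr_suml.
    apply: eq_bigr => j _; rewrite mul_diag_mx !mxE -!mulrA.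
    by rewrite mulrCA [RHS]mulrCA; congr (_ * _); rewrite mulrCA.
  have [<-|neq_ik] := eqVneq i k.
    by rewrite p_norm -1?ltnS // divff ?predistance_max_neq0 // -ltnS.
  by rewrite p_orth -1?ltnS // mul0r.
have := mulmx1C orth; rewrite -mulmxA; move: (W *m V) => Z /matrixP DZ.
apply/matrixP => i j; have := DZ i j; rewrite mul_diag_mx !mxE => DZij.
have m_neq0 : (m i)%:R != 0 :> R.
  by rewrite pnatr_eq0 -lt0n (spectrum_mult_gt0 spectrumA).
have mn_neq0 : (m i)%:R / n%:R != 0 :> R by rewrite mulf_neq0 ?invr_eq0.
apply: (mulfI mn_neq0); rewrite DZij mulrnAr.
by rewrite mulrA mulfVK // divff.
Qed.

End Predistance.

Theorem proposition3p6 (R : rcfType) (T : finType) (e : rel T) (d : nat)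
    (lambda : 'I_d.+1 -> R) (m : 'I_d.+1 -> nat) (p : nat -> {poly R})
    (alpha beta gamma : nat -> R)
    (e_simple : simple_graph e) (e_connected : connected_graph e)
    (e_spectrum : is_spectrum (adjacency_mx R e) lambda m)
    (p_predistance : predistance_polys (adjacency_mx R e) lambda p)
    (abc_preintersection : preintersection_numbers lambda p alpha beta gamma) :
  let M : 'M[R]_d.+1 := preintersection_mx d alpha beta gamma in
  ((forall a : R, eigenvalue M a <-> exists i, a = lambda i)
   /\ (forall a : R, root (char_poly M) a <-> exists i, a = lambda i))
  /\ ((forall i, exists! u, normalized_left_eigenvector M (lambda i) u)
      /\ (forall i, exists! v, normalized_right_eigenvector M (lambda i) v)
      /\ forall (u : 'I_d.+1 -> 'rV[R]_d.+1) (v : 'I_d.+1 -> 'cV[R]_d.+1),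
           (forall i, normalized_left_eigenvector M (lambda i) (u i)) ->
           (forall i, normalized_right_eigenvector M (lambda i) (v i)) ->
           #|T|%:R = std_ip (u ord0) (v ord0)
           /\ forall i, std_ip (u i) (v i) != 0
                /\ (m i)%:R = #|T|%:R / std_ip (u i) (v i)).
Proof.
move=> M; have [symE _] := e_simple; have [n_gt0 _] := e_connected.
have symA := adjacency_mx_sym R symE.
have inj := spectrum_inj e_spectrum.
have n_neq0 : #|T|%:R != 0 :> R by rewrite pnatr_eq0 -lt0n.
have m_neq0 i : (m i)%:R != 0 :> R.
  by rewrite pnatr_eq0 -lt0n (spectrum_mult_gt0 e_spectrum).
have c_neq0 i : #|T|%:R / (m i)%:R != 0 :> R by rewrite mulf_neq0 ?invr_eq0.
have MV := predistance_right_eigen abc_preintersection.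
have WV := predistance_dual_orthogonality n_gt0 symA e_spectrum p_predistance.
have p0 := predistance_p0 n_gt0 p_predistance.
set V := \matrix_(i, j) _ in MV WV; set W := (X in X *m V) in WV.
have V0 i : V ord0 i = 1 by rewrite mxE p0 hornerC.
have W0 i : W i ord0 = 1 by rewrite mxE p0 !hornerC divr1.
have rootM := root_char_poly_diagonalized c_neq0 MV WV.
have leftE := normalized_left_eigenvectorE inj c_neq0 MV WV W0.
have rightE := normalized_right_eigenvectorE inj c_neq0 MV WV V0.
split; first by split=> // a; rewrite eigenvalue_root_char.
split=> [i|].
  by exists (row i W); split=> [|u /leftE //]; apply/leftE.
split=> [i|].
  by exists (col i V); split=> [|v /rightE //]; apply/rightE.
move=> u v u_eig v_eig.
have ipE i : std_ip (u i) (v i) = #|T|%:R / (m i)%:R.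
  rewrite ((leftE i _).1 (u_eig i)) ((rightE i _).1 (v_eig i)).
  exact: (std_ip_eigenvectors WV).
split=> [|i].
  by rewrite ipE (max_eigenvalue_mult1 symE e_connected e_spectrum) divr1.
by rewrite ipE; split=> //; rewrite invf_div mulrC mulfVK.
Qed.
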